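(* For each $n\ge 1$ let $\mathbf A_n$, $\mathbf B_n$ and $\mathbf W_n$ be Hermitian random matrices of order $n$ (all defined on a common probability space), and for $n,k\ge 1$ let $\mathbb B_{n,k}=\mathbf I_k\otimes \mathbf A_n+\mathbf W_k\otimes \mathbf B_n$. Assume: (1) There exists a compactly supported probability measure $\mu_\omega$ on $\mathbb R$ such that $\mu_{\mathbf W_n}\xrightarrow{\mathfrak m}\mu_\omega$ as $n\to\infty$, almost surely. (2) For every real $t$ there exists a probability measure $\psi(t;\cdot)$ on $\mathbb R$ such that $\mu_{\mathbf A_n+t\mathbf B_n}\xrightarrow{\mathfrak m}\psi(t;\cdot)$ as $n\to\infty$, almost surely, and the support of $\psi(t;\cdot)$ is uniformly bounded for $t$ in any compact subset of $\mathbb R$. Then, almost surely, both iterated limits below exist in the sense of weak convergence of probability measures and $$\lim_{n\to\infty}\lim_{k\to\infty}\mu_{\mathbb B_{n,k}}=\lim_{k\to\infty}\lim_{n\to\infty}\mu_{\mathbb B_{n,k}}=\nu ,$$ where $\nu$ is the probability measure defined by $$\nu(dx)=\int_{\mathbb R}\psi(t;dx)\,\mu_\omega(dt).$$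
   Context: The spectral measure of an $n\times n$ Hermitian matrix $\mathbf A$ with eigenvalues $\lambda_1\le\dots\le\lambda_n$ is $\mu_{\mathbf A}=\frac1n\sum_{i=1}^n\delta_{\lambda_i}$; for a random matrix it is a random measure. The notation $\mu_n\xrightarrow{\mathfrak m}\mu$ means convergence of moments: $\lim_{n\to\infty}\int x^j\,\mu_n(dx)=\int x^j\,\mu(dx)$ for all integers $j\ge1$. $\mathbf I_k$ is the $k\times k$ identity matrix. The Kronecker product $\mathbf A\otimes\mathbf B$ of a $k\times k$ matrix $\mathbf A=(a_{ij})$ and an $n\times n$ matrix $\mathbf B$ is the $nk\times nk$ block matrix whose $(i,j)$ block is $a_{ij}\mathbf B$. *)

(* Defs.v *)
From HB Require Import structures.
From mathcomp Require Import all_boot all_order all_algebra spectral.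
From mathcomp Require Import complex mxtens.
From mathcomp Require Import all_classical all_reals all_analysis.
From mathcomp Require Import measurable_realfun.

Set Implicit Arguments.
Unset Strict Implicit.
Unset Printing Implicit Defensive.

Import Order.TTheory GRing.Theory Num.Theory.
Import numFieldNormedType.Exports.

Local Open Scope classical_set_scope.
Local Open Scope ring_scope.
Local Open Scope complex_scope.

(* [spectral_diag A] lists the eigenvalues with multiplicity for normal [A]
   (see [eigenvalues_char_poly]); it is a junk value for other matrices. *)
Definition eigenvalues (R : realType) (n : nat) (A : 'M[R[i]]_n) : seq R :=
  [seq complex.Re (spectral_diag A ord0 i) | i <- enum 'I_n].

Lemma size_eigenvalues (R : realType) (n : nat) (A : 'M[R[i]]_n) :
  size (eigenvalues A) = n.
Proof. by rewrite size_map size_enum_ord. Qed.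

Lemma eigenvalues_char_poly (R : realType) (n : nat) (A : 'M[R[i]]_n) :
  A \is hermsymmx ->
  char_poly A = \prod_(l <- eigenvalues A) ('X - (l%:C)%:P).
Proof.
move=> hA; have /mxOverP sr := hermitian_spectral_diag_real hA.
have /orthomx_spectralP eA := hermitian_normalmx hA.
have uP := spectral_unit A.
have -> : char_poly A = char_poly (diag_mx (spectral_diag A)).
  move: uP eA; set P := spectralmx A; set D := diag_mx _ => uP eA.
  have uQ : \det (map_mx polyC (invmx P)) * \det (map_mx polyC P) = 1.
    by rewrite -det_mulmx -map_mxM mulVmx// map_mx1 det1.
  rewrite /char_poly -[RHS]mul1r -uQ mulrAC -!det_mulmx; congr (\det _).
  rewrite /char_poly_mx [in LHS]eA mulmxBr mulmxBl !map_mxM; congr (_ - _).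
  by rewrite -mulmxA -scalar_mxC mulmxA -map_mxM mulVmx// map_mx1 mul1mx.
rewrite char_poly_trig; last exact: diag_mx_is_trig.
rewrite big_map big_enum /=; apply: eq_bigr => i _.
rewrite mxE eqxx mulr1n; congr ('X - _%:P).
by have := sr ord0 i; case: (spectral_diag A ord0 i) => a b; rewrite complex_real => /eqP ->.
Qed.

(* For a matrix of order 0 this is the zero measure. *)
Definition spectral_measure (R : realType) (n : nat) (A : 'M[R[i]]_n) :
    {measure set R -> \bar R} :=
  mscale (n%:R^-1)%:nng (msum (fun i => \d_((eigenvalues A)`_i)) n).

Lemma spectral_measureE (R : realType) (n : nat) (A : 'M[R[i]]_n) (U : set R) :
  spectral_measure A U
  = ((n%:R^-1)%:E * \sum_(i < n) \d_((eigenvalues A)`_i) U)%E.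
Proof. by []. Qed.

Lemma spectral_measure_setT (R : realType) (n : nat) (A : 'M[R[i]]_n) :
  (0 < n)%N -> spectral_measure A setT = 1%E.
Proof.
move=> n0; rewrite spectral_measureE.
under eq_bigr do rewrite diracT.
by rewrite sumEFin sumr_const card_ord -EFinM mulVf// pnatr_eq0 -lt0n.
Qed.

Definition hermitian_random_matrix (R : realType) (d : measure_display)
    (T : measurableType d) (n : nat) (X : T -> 'M[R[i]]_n) : Prop :=
  (forall w, X w \is hermsymmx) /\
  (forall i j, measurable_fun setT (fun w => complex.Re (X w i j)) /\
               measurable_fun setT (fun w => complex.Im (X w i j))).

Definition moments_cvg (R : realType) (mu_ : nat -> {measure set R -> \bar R})
    (mu : {measure set R -> \bar R}) : Prop :=
  forall j : nat, (0 < j)%N ->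
    (\int[mu_ n]_x (x ^+ j)%:E)%E @[n --> \oo] --> (\int[mu]_x (x ^+ j)%:E)%E.

Definition weak_cvg (R : realType) (mu_ : nat -> {measure set R -> \bar R})
    (mu : {measure set R -> \bar R}) : Prop :=
  forall f : R -> R, continuous f -> bounded_fun f ->
    (\int[mu_ n]_x (f x)%:E)%E @[n --> \oo] --> (\int[mu]_x (f x)%:E)%E.

Definition msupport (R : realType) (mu : {measure set R -> \bar R}) : set R :=
  [set x | forall U : set R, open U -> U x -> (0 < mu U)%E].

Definition kron_model (R : realType) (n k : nat) (A B : 'M[R[i]]_n)
    (W : 'M[R[i]]_k) : 'M[R[i]]_(k * n) :=
  tensmx 1%:M A + tensmx W B.

(* Main.v *)
(** The [j]-th moment of [A_n + t B_n] is a polynomial of degree at most [j] in [t],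
    and expanding [(I (x) A + W (x) B) ^ j] into tensors [W ^ l (x) Q_(j,l)] shows that
    the [j]-th moment of the Kronecker model is obtained from that polynomial by
    replacing [t ^ l] with the [l]-th moment of [W_k]. By Lagrange interpolation,
    almost sure convergence at [t = 0, 1, 2, ...] makes the coefficients converge,
    hence a single null set serves all [t], and the moments of [psi t] are polynomials
    in [t]. The inner limits are the mixtures of the spectral measures of
    [A_n + t B_n] over [mu_omega] and of [psi t] over the spectral measure of [W_k];
    all four limits are then limits of moments towards compactly supported measures,
    and such limits are weak since a bounded continuous function can be squeezed
    between two polynomials that are close on the support of the limit. *)

Require Import Defs.
From HB Require Import structures.
From mathcomp Require Import all_boot all_order all_algebra spectral.
From mathcomp Require Import complex mxtens.
From mathcomp Require Import all_classical all_reals all_analysis.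
From mathcomp Require Import measurable_realfun.
From mathcomp Require Import giry qpoly ring lra.

Set Implicit Arguments.
Unset Strict Implicit.
Unset Printing Implicit Defensive.

Import Order.TTheory GRing.Theory Num.Theory.
Import numFieldNormedType.Exports.

Local Open Scope classical_set_scope.
Local Open Scope ring_scope.
Local Open Scope complex_scope.

(** * Polynomial approximation *)

(* The Bernstein polynomial [sum_k 'C(n, k) g(k) X^k (1 - X)^(n - k)], unfolded by
   Pascal's rule so that no binomial coefficient occurs. *)
Fixpoint bernstein (R : nzRingType) (n : nat) (g : nat -> R) : {poly R} :=
  if n is n'.+1 then 'X * bernstein n' (g \o succn) + (1 - 'X) * bernstein n' g
  else (g 0)%:P.

Section Bernstein.
Variable R : realType.
Implicit Types (g h : nat -> R) (x : R).

Lemma bernsteinS n g x : (bernstein n.+1 g).[x] =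
  x * (bernstein n (g \o succn)).[x] + (1 - x) * (bernstein n g).[x].
Proof. by rewrite /= !hornerE. Qed.

Lemma bernstein_affine n g (a b x : R) :
  (bernstein n (fun k => a * g k + b)).[x] = a * (bernstein n g).[x] + b.
Proof.
elim: n g => [|n IH] g; first by rewrite !hornerC.
rewrite !bernsteinS IH (IH (g \o succn)); ring.
Qed.

(** Variance plus squared bias of a binomial variable. The centre [a] is free because the induction
    shifts it by one. *)
Lemma bernstein_sqr n (a x : R) :
  (bernstein n (fun k => (k%:R - a) ^+ 2)).[x]
  = n%:R * x * (1 - x) + (n%:R * x - a) ^+ 2.
Proof.
elim: n a => [|n IH] a; first by rewrite hornerC; ring.
rewrite bernsteinS IH.
have -> : (fun k => (k%:R - a) ^+ 2) \o succn = fun k => (k%:R - (a - 1)) ^+ 2.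
  by apply/funext => k /=; rewrite -natr1; congr (_ ^+ 2); ring.
rewrite IH -natr1; ring.
Qed.

Lemma le_bernstein n g h x : 0 <= x <= 1 -> (forall k, g k <= h k) ->
  (bernstein n g).[x] <= (bernstein n h).[x].
Proof.
move=> x01; elim: n g h => [|n IH] g h gh; first by rewrite !hornerC.
rewrite !bernsteinS; have /andP[x0 x1] := x01.
by apply: lerD; apply: ler_wpM2l; rewrite ?subr_ge0//; apply: IH => k; apply: gh.
Qed.

(** Only [x] is confined to the segment: the nodes [k / n] in [weierstrass01] range over all
    naturals [k] and may leave it. *)
Lemma segment_unif_continuous (f : R -> R) (a b e : R) : continuous f -> 0 < e ->
  exists2 d, 0 < d & forall x y, a <= x <= b -> `|x - y| < d -> `|f x - f y| < e.
Proof.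
move=> cf e0.
pose Q (d : R) x := forall y, `|x - y| < d -> `|f x - f y| < e.
have : \forall d \near 0^'+, `[a, b]%classic `<=` Q d.
  have /compact_near_coveringP := @segment_compact R a b.
  apply => x _.
  have /cvgrPdist_lt /(_ (e / 2)) := cf x.
  rewrite divr_gt0// => /(_ isT) /nbhs_ballP[d /= d0 xd].
  exists (ball x (d / 2), `]0, (d / 2)[%classic).
    split; first by apply: nbhsx_ballx; rewrite divr_gt0.
    near=> z; rewrite /= in_itv/=; apply/andP; split => //.
    by near: z; apply: nbhs_right_lt; rewrite divr_gt0.
  move=> [u r] /= [xu]; rewrite in_itv/= => /andP[r0 rd] y uy.
  have h1 := xd u; have h2 := xd y.
  rewrite /ball/= in xu h1 h2.
  have {}h1 : `|f x - f u| < e / 2 by apply: h1; lra.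
  have {}h2 : `|f x - f y| < e / 2.
    apply: h2; have -> : x - y = (x - u) + (u - y) by ring.
    by apply: le_lt_trans (ler_normD _ _) _; lra.
  have -> : f u - f y = (f x - f y) - (f x - f u) by ring.
  by apply: le_lt_trans (ler_normB _ _) _; lra.
move=> [d /= d0 Hd].
exists (d / 2) => [|x y xab]; first by rewrite divr_gt0.
apply: (Hd (d / 2)) => //=.
  by rewrite /ball/= sub0r normrN gtr0_norm; lra.
lra.
Unshelve. all: by end_near.
Qed.

Lemma weierstrass01 (f : R -> R) (e : R) :
  continuous f -> bounded_fun f -> 0 < e ->
  exists p : {poly R}, forall x, 0 <= x <= 1 -> `|f x - p.[x]| <= e.
Proof.
move=> cf /ex_strict_bound_gt0[M M0 fM] e0.
have {}fM x : `|f x| < M by exact: fM.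
have [d d0 fd] := segment_unif_continuous 0 1 cf (divr_gt0 e0 (ltr0n _ 2)).
pose K := 2 * M / d ^+ 2.
have K0 : 0 < K by rewrite divr_gt0 ?exprn_gt0// mulr_gt0.
(* Either [y] is near [x] and uniform continuity gives [e / 2], or [(y - x) ^ 2] is at least [d ^ 2]
   and the quadratic term is at least [2 * M]. *)
have fK x y : 0 <= x <= 1 -> `|f x - f y| <= K * (y - x) ^+ 2 + e / 2.
  move=> x01; have [/fd-/(_ x01)|dxy] := ltP (`|x - y|) d.
    by have := mulr_ge0 (ltW K0) (sqr_ge0 (y - x)); lra.
  apply: (@le_trans _ _ (2 * M)).
    by apply: le_trans (ler_normB _ _) _; have := fM x; have := fM y; lra.
  apply: (@le_trans _ _ (K * (y - x) ^+ 2)); last by lra.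
  rewrite /K mulrAC ler_pdivlMr ?exprn_gt0// ler_wpM2l//; first by lra.
  by rewrite -(real_normK (num_real (y - x))) distrC ler_sqr ?nnegrE// ltW.
pose n := (Num.bound (K * 2 / e)).+1.
have n0 : 0 < n%:R :> R by rewrite ltr0n.
exists (bernstein n (fun k => f (k%:R / n%:R))) => x x01.
have Kn : K / n%:R <= e / 2.
  rewrite ler_pdivrMr// mulrC -ler_pdivrMr; last by lra.
  rewrite invf_div mulrA; apply/ltW/(lt_le_trans (archi_boundP _)).
    by apply: divr_ge0; lra.
  by rewrite ler_nat.
have e1 : (bernstein n (fun k => K / n%:R ^+ 2 * (k%:R - n%:R * x) ^+ 2 + e / 2)).[x]
    <= e.
  rewrite bernstein_affine bernstein_sqr subrr expr0n addr0.
  have -> : K / n%:R ^+ 2 * (n%:R * x * (1 - x)) = K / n%:R * (x * (1 - x)).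
    by field; rewrite gt_eqF.
  have /andP[x0 x1] := x01.
  have : K / n%:R * (x * (1 - x)) <= K / n%:R * 1.
    by rewrite ler_wpM2l ?divr_ge0 ?ltW//; nra.
  lra.
have fb k : `|f x - f (k%:R / n%:R)| <= K / n%:R ^+ 2 * (k%:R - n%:R * x) ^+ 2 + e / 2.
  apply: le_trans (fK _ _ x01) _.
  suff -> : K * (k%:R / n%:R - x) ^+ 2 = K / n%:R ^+ 2 * (k%:R - n%:R * x) ^+ 2 by [].
  by field; rewrite gt_eqF.
(* Taking [s] to be [1] and [-1] gives the two one-sided bounds by monotonicity of the Bernstein
   operator. *)
have lin s : (bernstein n (fun k => s * f (k%:R / n%:R) - s * f x)).[x]
   = s * (bernstein n (fun k => f (k%:R / n%:R))).[x] - s * f x.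
  exact: bernstein_affine.
rewrite ler_norml; apply/andP; split.
  have : 1 * (bernstein n (fun k => f (k%:R / n%:R))).[x] - 1 * f x <= e.
    rewrite -lin; apply: le_trans e1; apply: le_bernstein => // k.
    by have := fb k; rewrite ler_norml => /andP[]; lra.
  lra.
have : -1 * (bernstein n (fun k => f (k%:R / n%:R))).[x] - -1 * f x <= e.
  rewrite -lin; apply: le_trans e1; apply: le_bernstein => // k.
  by have := fb k; rewrite ler_norml => /andP[]; lra.
lra.
Qed.

Lemma weierstrass (f : R -> R) (C e : R) :
  continuous f -> bounded_fun f -> 0 < C -> 0 < e ->
  exists p : {poly R}, forall x, `|x| <= C -> `|f x - p.[x]| <= e.
Proof.
move=> cf bf C0 e0.
have cg : continuous (fun s => f (2 * C * s - C)).
  move=> s; apply: continuous_comp; last exact: cf.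
  by apply: cvgB; [apply: cvgMr; exact: cvg_id|exact: cvg_cst].
have bg : bounded_fun (fun s => f (2 * C * s - C)).
  by move: bf => [M [Mr fM]]; exists M; split => // N /fM + s _; apply.
have [p fp] := weierstrass01 cg bg e0.
exists (p \Po ((2 * C)^-1 *: ('X + C%:P))) => x xC.
rewrite horner_comp !hornerE; set s := _ * _.
have -> : x = 2 * C * s - C by rewrite /s; field; rewrite gt_eqF.
apply: fp; move: xC; rewrite ler_norml /s mulrC => /andP[x1 x2].
rewrite divr_ge0 /= ?ler_pdivrMr; lra.
Qed.

(** The exponent is [size p] rather than the degree: for [1 <= |x|] this only weakens the bound, and
    it covers the zero polynomial. *)
Lemma horner_growth (p : {poly R}) :
  exists2 L, 0 <= L & forall x, 1 <= `|x| -> `|p.[x]| <= L * `|x| ^+ size p.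
Proof.
exists (\sum_(i < size p) `|p`_i|) => [|x x1]; first exact: sumr_ge0.
rewrite horner_coef; apply: le_trans (ler_norm_sum _ _ _) _.
rewrite mulr_suml ler_sum// => i _; rewrite normrM normrX ler_wpM2l//.
by rewrite ler_weXn2l// ltnW.
Qed.

(* The correction [K * (x / 2C) ^ 2r] dominates [f - g] outside [-2C, 2C] and is
   small on [-C, C] for large [r]. *)
Lemma poly_sandwich (f : R -> R) (C e : R) :
  continuous f -> bounded_fun f -> 0 < e ->
  exists p q : {poly R}, (forall x, p.[x] <= f x <= q.[x]) /\
    (forall x, `|x| <= C -> q.[x] - p.[x] <= e).
Proof.
(* The growth bound on [g] holds for [1 <= |x|], so [C] is raised to at least [1]. *)
move=> cf bf e0; wlog C1 : C / 1 <= C => [H|].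
  have [p [q [fpq Hpq]]] := H (Num.max C 1) ltac:(by rewrite le_max lexx orbT).
  by exists p, q; split => // x xC; apply: Hpq; rewrite le_max xC.
have C0 : 0 < C by lra.
have e4 : 0 < e / 4 by lra.
have C2 : 0 < 2 * C by lra.
have [g fg] := weierstrass cf bf C2 e4.
have [L L0 gL] := horner_growth g.
move: bf => /ex_strict_bound_gt0[M M0 fM].
have {}fM x : `|f x| < M by exact: fM.
set d := size g in gL.
(* For [2C < |x|] the gap [|f - g|] is at most [(M + L) |x| ^ d], that is, [K (|x| / 2C) ^ d]. The
   exponent [2r >= d] preserves this bound and, being even, keeps the correction nonnegative. *)
pose K := (M + L) * (2 * C) ^+ d.
have K0 : 0 < K by rewrite mulr_gt0 ?exprn_gt0//; lra.
have [r [dr Kr]] : exists r, (d <= 2 * r)%N /\ K * (2^-1) ^+ (2 * r) <= e / 4.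
  pose N := Num.bound (K / (e / 4)).
  exists (d + N)%N; split; first by rewrite mul2n -addnn -addnA leq_addr.
  rewrite exprVn ler_pdivrMr ?exprn_gt0// mulrC -ler_pdivrMr//.
  apply/ltW/(lt_le_trans (archi_boundP _)); first by apply: divr_ge0; lra.
  rewrite -natrX ler_nat; apply: leq_trans (ltnW (ltn_expl _ (ltnSn 1))) _.
  by rewrite leq_exp2l// mul2n -addnn addnA (leq_trans (leq_addl (d+N+d) N)).
pose h : {poly R} := (K * ((2 * C)^-1) ^+ (2 * r)) *: 'X^(2 * r).
have hE x : h.[x] = K * (`|x| / (2 * C)) ^+ (2 * r).
  rewrite /h !hornerE exprMn [in LHS]mulrAC mulrA.
  by rewrite -[in RHS]normrX ger0_norm// exprM exprn_ge0// sqr_ge0.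
have h0 x : 0 <= h.[x].
  by rewrite hE mulr_ge0 ?exprn_ge0 ?divr_ge0//; lra.
have fgh x : `|f x - g.[x]| <= e / 4 + h.[x].
  have [/fg|xC] := leP `|x| (2 * C); first by have := h0 x; lra.
  suff : `|f x - g.[x]| <= h.[x] by lra.
  apply: (@le_trans _ _ ((M + L) * `|x| ^+ d)).
    apply: le_trans (ler_normB _ _) _; rewrite mulrDl lerD//; last by apply: gL; lra.
    apply: (@le_trans _ _ (M * 1)); first by rewrite mulr1 ltW.
    by rewrite ler_wpM2l ?exprn_ege1//; lra.
  rewrite hE /K -mulrA ler_wpM2l//; first lra.
  have -> : `|x| ^+ d = (2 * C) ^+ d * (`|x| / (2 * C)) ^+ d.
    by rewrite -exprMn mulrC divfK// gt_eqF.
  rewrite ler_wpM2l ?exprn_ge0//; first lra.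
  by rewrite ler_weXn2l// ler_pdivlMr// mul1r ltW.
exists (g - (e / 4)%:P - h), (g + (e / 4)%:P + h); split => x.
  by have := fgh x; rewrite !hornerE ler_norml => /andP[]; lra.
move=> xC; rewrite !(hornerD, hornerN, hornerC).
have : h.[x] <= e / 4.
  rewrite hE; apply: le_trans Kr; apply: ler_wpM2l; first exact: ltW.
  apply: lerXn2r; rewrite ?nnegrE//; first by rewrite divr_ge0//; lra.
  by rewrite ler_pdivrMr//; lra.
lra.
Qed.

End Bernstein.

(** * Moments of compactly supported measures *)

Section CompactMoments.
Variable R : realType.
Implicit Types (mu : {measure set R -> \bar R}) (m : nat -> R) (C : R).
Implicit Types (f g : R -> R) (p q : {poly R}).

Definition supported_in mu C := mu (~` `[- C, C]%classic) = 0%E.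

(** The sequence is real-valued so that its limits live in [R]; the condition on [m 0] encodes total
    mass one. *)
Definition has_moments mu m := [/\ m 0 = 1, exists C, supported_in mu C &
  forall j, (\int[mu]_x (x ^+ j)%:E = (m j)%:E)%E].

(* The integral of [p] against any measure with moments [m]. *)
Definition mom m p := \sum_(i < size p) p`_i * m i.

Lemma mom_widen m p n : (size p <= n)%N -> mom m p = \sum_(i < n) p`_i * m i.
Proof.
move=> pn; rewrite /mom (big_ord_widen _ (fun i => p`_i * m i) pn) big_mkcond /=.
by apply: eq_bigr => i _; case: ltnP => // ip; rewrite nth_default ?mul0r.
Qed.

Lemma momXn m j : mom m 'X^j = m j.
Proof.
rewrite (@mom_widen _ _ j.+1) ?size_polyXn// big_ord_recr /= coefXn eqxx mul1r.
by rewrite big1 ?add0r// => i _; rewrite coefXn ltn_eqF// mul0r.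
Qed.

Lemma momC m e : m 0 = 1 -> mom m e%:P = e.
Proof.
by move=> m0; rewrite (@mom_widen _ _ 1) ?size_polyC_leq1// big_ord1 coefC m0 mulr1.
Qed.

Lemma momD m p q : mom m (p + q) = mom m p + mom m q.
Proof.
rewrite (@mom_widen _ _ (maxn (size p) (size q))) ?size_polyD//.
rewrite (@mom_widen _ p (maxn (size p) (size q))) ?leq_maxl//.
rewrite (@mom_widen _ q (maxn (size p) (size q))) ?leq_maxr//.
by rewrite -big_split; apply: eq_bigr => i _; rewrite coefD mulrDl.
Qed.

Lemma mom0 m : mom m 0 = 0.
Proof. by rewrite /mom size_poly0 big_ord0. Qed.

Lemma momZ m a p : mom m (a *: p) = a * mom m p.
Proof.
rewrite (@mom_widen _ _ (size p)) ?size_scale_leq// mulr_sumr.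
by apply: eq_bigr => i _; rewrite coefZ mulrA.
Qed.

Lemma momN m p : mom m (- p) = - mom m p.
Proof. by rewrite /mom size_polyN -sumrN; apply: eq_bigr => i _; rewrite coefN mulNr. Qed.

Lemma momB m p q : mom m (p - q) = mom m p - mom m q.
Proof. by rewrite momD momN. Qed.

Lemma cvg_mom (m_ : nat -> nat -> R) m p :
  (forall j, m_ n j @[n --> \oo] --> m j) -> mom (m_ n) p @[n --> \oo] --> mom m p.
Proof. by move=> mc; apply: cvg_big => [|i _]; [exact: add_continuous|apply: cvgMr; exact: mc]. Qed.

Lemma measurable_horner p : measurable_fun [set: R] (horner p).
Proof.
rewrite (_ : horner p = fun x => \sum_(i < size p) p`_i * x ^+ i); last first.
  by apply/funext => x; rewrite horner_coef.
by apply: measurable_sum => i; apply: measurable_funM => //; exact: exprn_measurable.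
Qed.

Lemma setTD_csupport C : setT `\` ~` `[- C, C]%classic = `[- C, C]%classic.
Proof. by rewrite setTD setCK. Qed.

Lemma measurable_csupport C : measurable (~` `[- C, C]%classic).
Proof. exact: measurableC. Qed.
Hint Resolve measurable_csupport : core.

Lemma has_moments_setT mu m : has_moments mu m -> mu setT = 1%E.
Proof.
by move=> [m0 _ /(_ 0)]; under eq_integral do rewrite expr0; rewrite integral_cst// mul1e m0.
Qed.

Lemma supported_integrable mu C f M : mu setT = 1%E -> supported_in mu C ->
  measurable_fun setT f -> (forall x, `|x| <= C -> `|f x| <= M) ->
  mu.-integrable setT (EFin \o f).
Proof.
move=> mu1 muC mf fM.
apply/(negligible_integrable _ _ _ muC) => //; first exact/measurable_EFinP.
rewrite setTD_csupport.
apply: (@le_integrable _ _ _ _ _ _ _ (cst M%:E)) => //.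
- by apply/measurable_EFinP; exact: measurable_funS mf.
- move=> x /=; rewrite in_itv/= => xC.
  by rewrite lee_fin (le_trans _ (ler_norm _))// fM// ler_norml.
apply/integrableP; split => //.
under eq_integral do rewrite /=.
rewrite integral_cst// lte_mul_pinfty//.
apply: le_lt_trans (ltry 1); rewrite -mu1; apply: le_measure => //; rewrite inE//.
Qed.

Lemma le_supported_integral mu C f g : supported_in mu C ->
  mu.-integrable setT (EFin \o f) -> mu.-integrable setT (EFin \o g) ->
  (forall x, `|x| <= C -> f x <= g x) ->
  (\int[mu]_x (f x)%:E <= \int[mu]_x (g x)%:E)%E.
Proof.
move=> muC fi gi fg.
rewrite (negligible_integral _ _ fi muC)//.
rewrite (negligible_integral _ _ gi muC)// setTD_csupport.
apply: le_integral => //.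
- exact: integrableS fi.
- exact: integrableS gi.
- by move=> x; rewrite inE /= in_itv/= => xC; rewrite lee_fin fg// ler_norml.
Qed.

Lemma has_moments_exists mu C : mu setT = 1%E -> supported_in mu C ->
  has_moments mu (fun j => fine (\int[mu]_x (x ^+ j)%:E)%E).
Proof.
move=> mu1 muC; split.
- by under eq_integral do rewrite expr0; rewrite integral_cst// mul1e mu1.
- by exists C.
move=> j; rewrite fineK//; apply: integrable_fin_num => //.
apply: (supported_integrable (M := C ^+ j) mu1 muC); first exact: exprn_measurable.
by move=> x xC; rewrite normrX; apply: lerXn2r; rewrite ?nnegrE// (le_trans _ xC).
Qed.

Lemma has_moments_horner mu m p : has_moments mu m ->
  mu.-integrable setT (fun x => (p.[x])%:E) /\ (\int[mu]_x (p.[x])%:E = (mom m p)%:E)%E.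
Proof.
move=> hm; have mu1 := has_moments_setT hm; case: hm => _ [C muC] hm.
have ix j : mu.-integrable setT (fun x => (x ^+ j)%:E).
  apply: (supported_integrable (M := C ^+ j) mu1 muC); first exact: exprn_measurable.
  by move=> x xC; rewrite normrX; apply: lerXn2r; rewrite ?nnegrE// (le_trans _ xC).
have pE : (fun x => (p.[x])%:E) = (fun x => \sum_(i < size p) ((p`_i)%:E * (x ^+ i)%:E))%E.
  by apply/funext => x; rewrite horner_coef -sumEFin.
rewrite pE; split.
  by apply: integrable_sum => // i _; exact: integrableZl.
rewrite integral_sum//; last by move=> i; exact: integrableZl.
by rewrite /mom -sumEFin; apply: eq_bigr => i _; rewrite integralZl// hm.
Qed.

(* Every monomial is a difference of nonnegative polynomials. *)
Lemma has_moments_ge0 mu C m : mu setT = 1%E -> supported_in mu C ->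
  (forall p, (forall x, 0 <= p.[x]) -> (\int[mu]_x (p.[x])%:E = (mom m p)%:E)%E) ->
  has_moments mu m.
Proof.
move=> mu1 muC mE; have hm' := has_moments_exists mu1 muC.
suff <- : (fun j => fine (\int[mu]_x (x ^+ j)%:E)%E) = m by [].
set m' := (fun j => _) in hm' *; apply/funext => j.
have m'E p : (forall x, 0 <= p.[x]) -> mom m' p = mom m p.
  by move=> p0; apply: EFin_inj; rewrite -mE// (has_moments_horner p hm').2.
rewrite -[LHS](momXn m') -[RHS](momXn m).
have -> : 'X^j = ('X^(2 * j) + 'X^j + 1%:P) - ('X^(2 * j) + 1%:P) :> {poly R}.
  by rewrite polyC1; ring.
have e x : x ^+ (2 * j) = (x ^+ j) ^+ 2 :> R by rewrite -exprM mulnC.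
by rewrite !momB !m'E// => x; rewrite !hornerE e; nra.
Qed.

Lemma bounded_integrable mu m f : has_moments mu m -> continuous f ->
  bounded_fun f -> mu.-integrable setT (EFin \o f).
Proof.
move=> hm cf /ex_strict_bound_gt0[M _ fM]; have mu1 := has_moments_setT hm.
have [_ [C muC] _] := hm.
apply: (supported_integrable (M := M) mu1 muC); first exact: continuous_measurable_fun.
by move=> x _; apply/ltW/fM.
Qed.

Lemma sandwich_integral mu m f p q : has_moments mu m -> continuous f ->
  bounded_fun f -> (forall x, p.[x] <= f x <= q.[x]) ->
  exists2 a, (\int[mu]_x (f x)%:E = a%:E)%E & mom m p <= a <= mom m q.
Proof.
move=> hm cf bf pfq; have fi := bounded_integrable hm cf bf.
have [pi pE] := has_moments_horner p hm; have [qi qE] := has_moments_horner q hm.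
exists (fine (\int[mu]_x (f x)%:E)); first by rewrite fineK// integrable_fin_num.
rewrite -!lee_fin -pE -qE fineK ?integrable_fin_num//; apply/andP; split;
  by apply: le_integral => // x _; rewrite lee_fin; case/andP: (pfq x).
Qed.

Lemma mom_le mu m C p (e : R) : has_moments mu m -> supported_in mu C ->
  (forall x, `|x| <= C -> p.[x] <= e) -> mom m p <= e.
Proof.
move=> hm muC pe; have [pi pE] := has_moments_horner p hm.
have [ei eE] := has_moments_horner (e%:P) hm.
have [m0 _ _] := hm; rewrite -[leRHS](momC _ m0) -lee_fin -pE -eE.
by apply: (le_supported_integral muC) => // x xC; rewrite hornerC pe.
Qed.

(** The polynomials squeezing [f] have integrals that converge with the moments and differ by at
    most [e / 2] in the limit. The squeeze holds on the whole line, so it applies to [mu_ n]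
    wherever its mass lies. The condition on [mu_ n] is eventual because a matrix of order 0 has the
    zero spectral measure. *)
Lemma weak_cvg_of_moments (mu_ : nat -> {measure set R -> \bar R}) mu
    (m_ : nat -> nat -> R) m :
  (\forall n \near \oo, has_moments (mu_ n) (m_ n)) -> has_moments mu m ->
  (forall j, m_ n j @[n --> \oo] --> m j) -> weak_cvg mu_ mu.
Proof.
move=> hm_ hm mc f cf bf.
have fi := bounded_integrable hm cf bf.
rewrite -(@fineK _ (\int[mu]_x _)%E) ?integrable_fin_num//.
apply/fine_cvgP; split.
  near=> n; have hmn : has_moments (mu_ n) (m_ n) by near: n.
  by apply: integrable_fin_num => //; exact: bounded_integrable hmn cf bf.
apply/cvgrPdist_le => e e0; have e2 : 0 < e / 2 by rewrite divr_gt0.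
have [_ [C muC] _] := hm.
have [p [q [pfq pq]]] := poly_sandwich C cf bf e2.
have [a aE /andP[pa aq]] := sandwich_integral hm cf bf pfq.
have {}pq : mom m q - mom m p <= e / 2.
  by rewrite -momB; apply: mom_le hm muC _ => x xC; rewrite !hornerE pq.
near=> n.
have hmn : has_moments (mu_ n) (m_ n) by near: n.
have [b bE /andP[pb bq]] := sandwich_integral hmn cf bf pfq.
rewrite aE /= bE /=.
have : `|mom m p - mom (m_ n) p| <= e / 2.
  by near: n; move/cvgrPdist_le: (@cvg_mom m_ m p mc); apply.
have : `|mom m q - mom (m_ n) q| <= e / 2.
  by near: n; move/cvgrPdist_le: (@cvg_mom m_ m q mc); apply.
rewrite !ler_norml => /andP[? ?] /andP[? ?]; apply/andP; split; lra.
Unshelve. all: by end_near.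
Qed.

Lemma moments_cvg_real (mu_ : nat -> {measure set R -> \bar R}) mu
    (m_ : nat -> nat -> R) m :
  (\forall n \near \oo, has_moments (mu_ n) (m_ n)) -> has_moments mu m ->
  moments_cvg mu_ mu -> forall j, m_ n j @[n --> \oo] --> m j.
Proof.
(* [moments_cvg] starts at the first moment; the zeroth ones are eventually constant. *)
move=> hm_ hm mc [|j].
  have [-> _ _] := hm; apply: cvg_near_cst; near=> n.
  by have [] : has_moments (mu_ n) (m_ n) by near: n.
have [_ _ hj] := hm; have := mc j.+1 isT; rewrite hj => mcj.
move/fine_cvgP: mcj => -[_]; apply: cvg_trans; apply: near_eq_cvg; near=> n => /=.
by have [_ _ ->] : has_moments (mu_ n) (m_ n) by near: n.
Unshelve. all: by end_near.
Qed.

(** Every point off the segment lies in a null ball with rational centre and radius, and there are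
    countably many of these. *)
Lemma msupport_supported_in mu C : msupport mu `<=` `[- C, C]%classic -> supported_in mu C.
Proof.
move=> muC.
pose I (ab : rat * rat) : set R := ball (ratr ab.1 : R) (ratr ab.2).
pose N ab : set R := if mu (I ab) == 0%E then I ab else set0.
have mI ab : measurable (I ab) by exact: measurable_ball.
have mN ab : measurable (N ab) by rewrite /N; case: ifP.
have : mu.-negligible (\bigcup_n oapp N set0 (unpickle n)).
  apply: negligible_bigcup => n; case: (unpickle n) => [ab|] /=; last exact: negligible_set0.
  by apply/negligibleP => //; rewrite /N; case: ifPn => [/eqP//|_]; exact: measure0.
suff sub : ~` `[- C, C]%classic `<=` \bigcup_n oapp N set0 (unpickle n).
  by move=> /(negligibleS sub)/negligibleP; apply; exact: measurable_csupport.
move=> x xC.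
have : ~ msupport mu x by move=> /muC.
move=> /existsNP[U /not_implyP[oU /not_implyP[Ux /negP]]].
rewrite -leNgt => U0.
have [c [r [/set_mem xB BU]]] := open_subball_rat oU (mem_set Ux).
have [n nE] : exists n, unpickle n = Some (c, r).
  by exists (pickle (c, r)); exact: pickleK.
exists n => //; rewrite nE /= /N ifT// -measure_le0.
by apply: le_trans U0; apply: le_measure => //; rewrite inE//; exact: open_measurable.
Qed.

End CompactMoments.

(** * Mixtures *)

Section ProbabilityOfMass1.
Context d (T : measurableType d) (R : realType) (mu : {measure set T -> \bar R}).
Hypothesis mu1 : mu setT = 1%E.

(* The phantom argument carries the proof that the instance below needs. *)
Definition mass1_prob of mu setT = 1%E : set T -> \bar R := mu.

HB.instance Definition _ := Measure.on (mass1_prob mu1).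
HB.instance Definition _ := Measure_isProbability.Build _ _ _ (mass1_prob mu1) mu1.

Lemma probability_of_mass1 : exists P : probability T R, P = mu :> (set T -> \bar R).
Proof. by exists (mass1_prob mu1). Qed.

End ProbabilityOfMass1.

(** * Continuous approximation of rays *)

Section Ramp.
Variable R : realType.
Implicit Types (mu : {measure set R -> \bar R}) (x y : R).

(** For [n > 0], zero up to [x] and one from [x + 1 / n] on: these functions increase to the
    indicator of the open ray. *)
Definition ramp (n : nat) x y := Num.min 1 (n%:R * Num.max 0 (y - x)).

Lemma continuous_ramp n x : continuous (ramp n x).
Proof.
move=> y; apply: (@continuous_min _ _ (cst 1) (fun z => n%:R * Num.max 0 (z - x))).
  exact: cvg_cst.
apply: cvgMr; apply: (@continuous_max _ _ (cst 0) (fun z => z - x)).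
  exact: cvg_cst.
by apply: cvgB; [exact: cvg_id|exact: cvg_cst].
Qed.

Lemma ramp_ge0 n x y : 0 <= ramp n x y.
Proof. by rewrite le_min ler01 mulr_ge0// le_max lexx. Qed.

Lemma ramp_le1 n x y : ramp n x y <= 1.
Proof. by rewrite ge_min lexx. Qed.

Lemma bounded_ramp n x : bounded_fun (ramp n x).
Proof.
exists 1; split => // M M1 y _ /=.
by rewrite ger0_norm ?ramp_ge0// (le_trans (ramp_le1 _ _ _))// ltW.
Qed.

Lemma ramp_nondecreasing x y : {homo ramp ^~ x ^~ y : n m / (n <= m)%N >-> n <= m}.
Proof.
move=> n m nm; rewrite /ramp le_min ge_min lexx /= ge_min; apply/orP; right.
by rewrite ler_wpM2r ?ler_nat// le_max lexx.
Qed.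

Lemma cvg_ramp x y : ramp n x y @[n --> \oo] --> (\1_(`]x, +oo[%classic) y : R).
Proof.
rewrite indicE; have [xy|yx] := ltP x y.
  rewrite mem_set/= ?in_itv/= ?andbT//; apply: cvg_near_cst; near=> n.
  have n0 : (y - x)^-1 <= n%:R by near: n; exact: nbhs_infty_ger.
  rewrite /ramp min_l// max_r ?subr_ge0 ?(ltW xy)//.
  by rewrite -ler_pdivrMr ?subr_gt0// mul1r.
rewrite memNset/=; last by rewrite in_itv/= andbT; apply/negP; rewrite -leNgt.
apply: cvg_near_cst; near=> n.
by rewrite /ramp max_l ?subr_le0// mulr0 min_r.
Unshelve. all: by end_near.
Qed.

Lemma cvg_integral_ramp mu x :
  (\int[mu]_y (ramp n x y)%:E @[n --> \oo] --> mu `]x, +oo[%classic)%E.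
Proof.
have mr n : measurable_fun setT (EFin \o ramp n x).
  by apply/measurable_EFinP; apply: continuous_measurable_fun; exact: continuous_ramp.
have := @cvg_monotone_convergence _ _ _ mu setT measurableT
  (fun n => EFin \o ramp n x) mr.
suff -> : (\int[mu]_y limn (fun n => (EFin \o ramp n x) y) = mu `]x, +oo[%classic)%E.
  apply; first by move=> n y _; rewrite /= lee_fin ramp_ge0.
  by move=> y _ n m nm; rewrite /= lee_fin; exact: ramp_nondecreasing.
rewrite -[in RHS](setIT `]x, +oo[%classic) -integral_indic//.
apply: eq_integral => y _; apply/cvg_lim => //.
by apply: cvg_EFin; [exact: nearW|exact: cvg_ramp].
Qed.

End Ramp.

Section Mixture.
Variables (R : realType) (phi : R -> probability R R) (p_ : nat -> {poly R}).
Hypothesis phi_supp : forall K : R, exists C : R, forall t, `|t| <= K -> supported_in (phi t) C.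
Hypothesis phi_mom : forall t j, (\int[phi t]_x (x ^+ j)%:E = ((p_ j).[t])%:E)%E.

Let phi_moments t : has_moments (phi t) (fun j => (p_ j).[t]).
Proof.
split; last exact: phi_mom.
- have := phi_mom t 0; under eq_integral do rewrite expr0.
  by rewrite integral_cst// mul1e [X in X = _ -> _]probability_setT => -[].
- by have [C phiC] := phi_supp `|t|; exists C; exact: phiC.
Qed.

(** The integral of [q] against [phi t], as a polynomial in [t]. *)
Definition mompoly (q : {poly R}) := \sum_(i < size q) q`_i *: p_ i.

Lemma horner_mompoly q t : (mompoly q).[t] = mom (fun j => (p_ j).[t]) q.
Proof. by rewrite horner_sum; apply: eq_bigr => i _; rewrite hornerZ. Qed.

Lemma mom_mompoly m q : mom m (mompoly q) = mom (fun j => mom m (p_ j)) q.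
Proof.
rewrite /mompoly (big_morph _ (momD m) (mom0 m)).
by apply: eq_bigr => i _; rewrite momZ.
Qed.

(** For [|t| <= n] one support bound serves all [phi t], so a single polynomial below [f] has
    integrals within [1 / (n + 1)] of those of [f]. These are polynomial in [t], and pointwise
    limits of polynomials are measurable. *)
Lemma measurable_integral_family (f : R -> R) : continuous f -> bounded_fun f ->
  measurable_fun setT (fun t => \int[phi t]_x (f x)%:E)%E.
Proof.
move=> cf bf.
have /choice[q fq] (n : nat) : exists q : {poly R}, forall t, `|t| <= n%:R ->
    `|fine (\int[phi t]_x (f x)%:E)%E - (mompoly q).[t]| <= n.+1%:R^-1.
  have [C phiC] := phi_supp n%:R.
  have n1 : 0 < n.+1%:R^-1 :> R by rewrite invr_gt0.
  have [p [q [pfq pq]]] := poly_sandwich C cf bf n1.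
  exists p => t tn; rewrite horner_mompoly.
  have [a -> /andP[pa aq]] := sandwich_integral (phi_moments t) cf bf pfq.
  have : mom (fun j => (p_ j).[t]) q - mom (fun j => (p_ j).[t]) p <= n.+1%:R^-1.
    rewrite -momB; apply: mom_le (phi_moments t) (phiC _ tn) _ => x xC.
    by rewrite hornerD hornerN pq.
  by move=> qp; rewrite [fine _]/= ger0_norm ?subr_ge0// (le_trans _ qp)// lerB.
have -> : (fun t => \int[phi t]_x (f x)%:E)%E
    = EFin \o (fun t => fine (\int[phi t]_x (f x)%:E)%E).
  apply/funext => t /=; rewrite fineK// integrable_fin_num//.
  exact: bounded_integrable (phi_moments t) cf bf.
apply/measurable_EFinP.
apply: (measurable_fun_cvg (h := fun n => horner (mompoly (q n)))).
  by move=> n; exact: measurable_horner.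
move=> t _; apply/cvgrPdist_le => e e0; near=> n.
apply: le_trans (fq _ _ _) _; first by near: n; exact: nbhs_infty_ger.
by near: n; have := near_infty_natSinv_lt (PosNum e0); apply: filterS => n /ltW.
Unshelve. all: by end_near.
Qed.

(** Pi-lambda induction from the open rays, which are stable under intersection and whose masses are
    limits of integrals of ramps. *)
Lemma measurable_family (U : set R) : measurable U ->
  measurable_fun setT (fun t => phi t U).
Proof.
have mE : @measurable _ R = <<s @RGenOInfty.G R >> := RGenOInfty.measurableE R.
rewrite mE; move: U.
apply: (dynkin_induction (P := fun U => measurable_fun setT (fun t => phi t U))).
- exact: mE.
- move=> _ _ [x ->] [y ->]; exists (Num.max x y).
  by apply/seteqP; split => z /=; rewrite !in_itv/= !andbT gt_max => /andP.
- by apply: (eq_measurable_fun (cst 1%E)) => // t _; rewrite [RHS]probability_setT.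
- move=> _ [x ->]; apply: emeasurable_fun_cvg => [n|t _]; last first.
    exact: cvg_integral_ramp.
  by apply: measurable_integral_family; [exact: continuous_ramp|exact: bounded_ramp].
- move=> S mS IH; apply: (eq_measurable_fun (fun t => 1 - phi t S)%E).
    by move=> t _; rewrite probability_setC.
  exact: emeasurable_funB.
- move=> F mF tF IH.
  apply: (eq_measurable_fun (fun t => \sum_(0 <= k <oo) phi t (F k))%E).
    by move=> t _; rewrite measure_semi_bigcup//; exact: bigcup_measurable.
  exact: ge0_emeasurable_sum.
Qed.

(** The mixture is the bind of the Giry monad; its moments come from integrating the polynomials
    [mompoly q] against [mu]. *)
Lemma mixture_exists (mu : probability R R) m : has_moments mu m ->
  exists nu : probability R R,
    (forall U, measurable U -> nu U = (\int[mu]_t phi t U)%E) /\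
    has_moments nu (fun j => mom m (p_ j)).
Proof.
move=> hm.
have mphi : measurable_fun [set: R] (phi : R -> giry R R).
  exact: measurable_giry_codensity measurable_family.
have bindE U : measurable U -> giry_bind mu mphi U = (\int[mu]_t phi t U)%E.
  move=> mU; rewrite -[in LHS](setIT U) -[LHS]integral_indic//.
  rewrite [LHS]giry_int_bind//; last exact/measurable_EFinP/measurable_indic.
  by apply: eq_integral => t _; rewrite /giry_int integral_indic// setIT.
have : giry_bind mu mphi setT = 1%E.
  rewrite bindE//; under eq_integral => t _ do rewrite (probability_setT (phi t)).
  by rewrite integral_cst// mul1e; exact: probability_setT.
move=> /probability_of_mass1[nu nuE].
have nuU U : measurable U -> nu U = (\int[mu]_t phi t U)%E.
  by move=> mU; have /= -> := congr1 (fun P : set R -> \bar R => P U) nuE; exact: bindE.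
have [_ [C muC] _] := hm; have [C' phiC] := phi_supp C.
have nuC : supported_in nu C'.
  suff : nu (~` `[- C', C']%classic) = 0%E by [].
  rewrite nuU; last exact: measurable_csupport.
  have mphiC := measurable_family (measurable_csupport C').
  (* [mu] charges only [|t| <= C], where [C'] bounds the supports of all [phi t]. *)
  rewrite (ge0_negligible_integral _ _ _ _ muC)//; last exact: measurable_csupport.
  rewrite setTD_csupport integral0_eq// => t /=; rewrite in_itv/= => tC.
  by apply: phiC; rewrite ler_norml.
exists nu; split => //.
(* With [q] nonnegative, the integration rule for the bind applies to it. *)
apply: has_moments_ge0 (probability_setT nu) nuC _ => q q0.
rewrite -mom_mompoly -(has_moments_horner (mompoly q) hm).2.
rewrite (eq_measure_integral (giry_bind mu mphi)) => [|U mU _]; last first.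
  exact: etrans (nuU _ mU) (esym (bindE _ mU)).
rewrite [LHS]giry_int_bind//.
  apply: eq_integral => t _; rewrite horner_mompoly.
  by rewrite -(has_moments_horner q (phi_moments t)).2.
by apply/measurable_EFinP; exact: measurable_horner.
Qed.

End Mixture.

(** * Traces of powers *)

Section PowerCoefficients.
Variables (K : pzRingType) (n : nat) (A B : 'M[K]_n).

(* The coefficient of [t ^ l] in [(A + t B) ^ j], where [A] and [B] need not commute. *)
Fixpoint pow_coef (j l : nat) : 'M[K]_n :=
  if j is j'.+1 then
    A *m pow_coef j' l + (if l is l'.+1 then B *m pow_coef j' l' else 0)
  else if l is 0 then 1%:M else 0.

Lemma pow_coef_default j l : (j < l)%N -> pow_coef j l = 0.
Proof.
elim: j l => [|j IH] [|l]//=; rewrite ltnS => jl.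
by rewrite !IH// ?mulmx0 ?addr0// ltnW.
Qed.

(** [F l Q] abstracts [t ^ l Q]: only additivity matters, and that [F] turns products by [A] and [B]
    into products by [a] and [b]. This covers both the scalar pencil and the Kronecker one. *)
Lemma pow_coef_expand (S : pzRingType) (a b : S) (F : nat -> {additive 'M[K]_n -> S}) :
  F 0 1%:M = 1 -> (forall l Q, F l (A *m Q) = a * F l Q) ->
  (forall l Q, F l.+1 (B *m Q) = b * F l Q) ->
  forall j, (a + b) ^+ j = \sum_(l < j.+1) F l (pow_coef j l).
Proof.
move=> F1 Fa Fb; elim=> [|j IH]; first by rewrite expr0 big_ord1.
rewrite exprS IH mulrDl /=.
under [RHS]eq_bigr do rewrite raddfD /= Fa.
(* The last term of the first sum and the first term of the second vanish; what remains matches the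
   [j.+1] terms of the induction hypothesis. *)
rewrite big_split /= [X in _ = X + _]big_ord_recr /= pow_coef_default// raddf0 mulr0 addr0.
rewrite [X in _ = _ + X]big_ord_recl /= raddf0 add0r !mulr_sumr.
by congr (_ + _); apply: eq_bigr => i _; rewrite Fb.
Qed.

End PowerCoefficients.

(** * Traces and powers of Kronecker products *)

Section TensorTrace.
Variable K : comPzRingType.

Lemma mxtrace_tens m n (M : 'M[K]_m) (N : 'M[K]_n) : \tr (tensmx M N) = \tr M * \tr N.
Proof. by rewrite /mxtrace mulr_sum; apply: eq_bigr => i _; rewrite mxE. Qed.

Lemma tensmx1 m n : tensmx (1%:M : 'M[K]_m) (1%:M : 'M[K]_n) = 1%:M.
Proof.
apply/matrixP => i j; rewrite !mxE -natrM mulnb; congr (_%:R).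
rewrite -[in RHS](mxtens_unindexK i) -[in RHS](mxtens_unindexK j).
rewrite (can_eq (@mxtens_indexK _ _)).
by case: (mxtens_unindex i) (mxtens_unindex j) => ? ? [? ?].
Qed.

(** Additivity lets [tensmx (W ^+ l)] serve as the [F l] of [pow_coef_expand]. *)
Fact tensmx_is_additive m n p q (M : 'M[K]_(m, n)) :
  zmod_morphism (tensmx M : 'M[K]_(p, q) -> _).
Proof. by move=> X Y; apply/matrixP => i j; rewrite !mxE mulrBr. Qed.
HB.instance Definition _ m n p q (M : 'M[K]_(m, n)) :=
  GRing.isZmodMorphism.Build 'M[K]_(p, q) 'M[K]_(m * p, n * q) (tensmx M)
    (@tensmx_is_additive m n p q M).

Lemma expr_pencil n (A B : 'M[K]_n) t j :
  (A + t *: B) ^+ j = \sum_(l < j.+1) t ^+ l *: pow_coef A B j l.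
Proof.
apply: (pow_coef_expand (F := fun l => *:%R (t ^+ l) : {additive 'M[K]_n -> 'M[K]_n})).
- by rewrite /= expr0 scale1r.
- by move=> l Q; rewrite /= [RHS]/GRing.mul/= -scalemxAr.
- by move=> l Q; rewrite /= [RHS]/GRing.mul/= -scalemxAl -scalemxAr scalerA exprS.
Qed.

Lemma expr_tens_pencil k n (A B : 'M[K]_n) (W : 'M[K]_k) j :
  (tensmx 1%:M A + tensmx W B) ^+ j
  = \sum_(l < j.+1) tensmx (W ^+ l) (pow_coef A B j l).
Proof.
apply: (pow_coef_expand
  (F := fun l => tensmx (W ^+ l) : {additive 'M[K]_n -> 'M[K]_(k * n)})).
- exact: tensmx1.
- by move=> l Q; rewrite /= [RHS]tensmx_mul mul1mx.
- by move=> l Q; rewrite /= [RHS]tensmx_mul exprS.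
Qed.

End TensorTrace.

Lemma expr_conj_diag (K : comUnitRingType) n (P : 'M[K]_n) (D : 'rV[K]_n) j :
  P \in unitmx -> (invmx P *m diag_mx D *m P) ^+ j
                  = invmx P *m diag_mx (map_mx (fun x => x ^+ j) D) *m P.
Proof.
move=> uP; elim: j => [|j IH].
  rewrite expr0 (_ : diag_mx _ = 1%:M) ?mulmx1 ?mulVmx//.
  by apply/matrixP => a b; rewrite !mxE expr0.
rewrite exprS IH [LHS]/GRing.mul/= !mulmxA mulmxK//.
rewrite -[in LHS](mulmxA (invmx P) (diag_mx D)) mulmx_diag.
by congr (_ *m diag_mx _ *m _); apply/rowP => a; rewrite !mxE exprS.
Qed.

(** * Spectral moments of Hermitian matrices *)

Section Hermitian.
Variable R : realType.
Local Notation C := R[i].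

Lemma hermsymmxP n (A : 'M[C]_n) :
  reflect (forall i j, A i j = (A j i)^*%C) (A \is hermsymmx).
Proof.
apply: (iffP (is_hermitianmxP _ _ _)) => [AE i j|AE].
  by rewrite [in LHS]AE expr0 scale1r !mxE.
by apply/matrixP => i j; rewrite expr0 scale1r !mxE.
Qed.

Lemma hermsymmx_pencil n (A B : 'M[C]_n) (t : R) :
  A \is hermsymmx -> B \is hermsymmx -> A + t%:C *: B \is hermsymmx.
Proof.
move=> /hermsymmxP hA /hermsymmxP hB; apply/hermsymmxP => i j.
rewrite !mxE (hA i j) (hB i j) rmorphD rmorphM /=; congr (_ + _ * _).
by rewrite oppr0.
Qed.

Lemma hermsymmx_kron n k (A B : 'M[C]_n) (W : 'M[C]_k) : A \is hermsymmx ->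
  B \is hermsymmx -> W \is hermsymmx -> kron_model A B W \is hermsymmx.
Proof.
move=> /hermsymmxP hA /hermsymmxP hB /hermsymmxP hW; apply/hermsymmxP => i j.
rewrite !mxE (hA (mxtens_unindex i).2) (hB (mxtens_unindex i).2).
rewrite (hW (mxtens_unindex i).1) rmorphD !rmorphM /=; congr (_ * _ + _).
by rewrite eq_sym; case: eqP => _ /=; rewrite oppr0.
Qed.

(** By the spectral theorem [A] is conjugate to a real diagonal matrix, and the trace is cyclic. *)
Lemma mxtrace_expr n (A : 'M[C]_n) j : A \is hermsymmx ->
  \tr (A ^+ j) = (\sum_(i < n) (eigenvalues A)`_i ^+ j)%:C.
Proof.
move=> hA; have /mxOverP sr := hermitian_spectral_diag_real hA.
have /orthomx_spectralP eA := hermitian_normalmx hA.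
have uP := spectral_unit A.
set P := spectralmx A in eA uP; set D := spectral_diag A in eA sr.
have -> : A ^+ j = invmx P *m diag_mx (map_mx (fun x => x ^+ j) D) *m P.
  by rewrite [in LHS]eA expr_conj_diag.
rewrite mxtrace_mulC mulmxA mulmxV// mul1mx mxtrace_diag rmorph_sum /=.
apply: eq_bigr => i _; rewrite mxE rmorphXn /=; congr (_ ^+ _).
rewrite (nth_map i) ?size_enum_ord// nth_ord_enum -/D.
by have := sr ord0 i; case: (D ord0 i) => a b; rewrite complex_real => /eqP ->.
Qed.

Lemma Re_mxtrace_sum n m (F : 'I_m -> 'M[C]_n) :
  complex.Re (\tr (\sum_l F l)) = \sum_l complex.Re (\tr (F l)).
Proof. by rewrite (big_morph _ (@mxtraceD _ n) (@mxtrace0 _ n)) raddf_sum. Qed.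

(** The real part makes the moment an element of [R]; for Hermitian [A] the trace is already real by
    [mxtrace_expr]. *)
Definition trace_moment n (A : 'M[C]_n) (j : nat) : R :=
  n%:R^-1 * complex.Re (\tr (A ^+ j)).

Lemma trace_momentE n (A : 'M[C]_n) j : A \is hermsymmx ->
  trace_moment A j = n%:R^-1 * \sum_(i < n) (eigenvalues A)`_i ^+ j.
Proof. by move=> hA; rewrite /trace_moment mxtrace_expr. Qed.

Definition pencil_moment n (A B : 'M[C]_n) (j : nat) : {poly R} :=
  \poly_(l < j.+1) (n%:R^-1 * complex.Re (\tr (pow_coef A B j l))).

(** As [t] is real, real parts may be taken coefficient by coefficient. *)
Lemma horner_pencil_moment n (A B : 'M[C]_n) j (t : R) :
  (pencil_moment A B j).[t] = trace_moment (A + t%:C *: B) j.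
Proof.
rewrite horner_poly /trace_moment expr_pencil Re_mxtrace_sum mulr_sumr.
apply: eq_bigr => l _; rewrite /= mxtraceZ -rmorphXn.
by case: (\tr _) => a b /=; rewrite mul0r subr0 mulrAC -mulrA.
Qed.

(** The trace of a tensor product factors and the trace of [W ^+ l] is real, so each [t ^ l] in the
    pencil moment becomes the [l]-th moment of [W]. *)
Lemma trace_moment_kron n k (A B : 'M[C]_n) (W : 'M[C]_k) j : W \is hermsymmx ->
  trace_moment (kron_model A B W) j = mom (trace_moment W) (pencil_moment A B j).
Proof.
move=> hW; rewrite (@mom_widen _ _ _ j.+1) ?size_poly//.
rewrite /trace_moment expr_tens_pencil Re_mxtrace_sum mulr_sumr.
apply: eq_bigr => l _; rewrite /= coef_poly ltn_ord mxtrace_tens mxtrace_expr//.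
rewrite natrM invfM; case: (\tr _) => a b /=; rewrite mul0r subr0; ring.
Qed.

Lemma spectral_measure_supported n (A : 'M[C]_n) c :
  (forall i : 'I_n, `|(eigenvalues A)`_i| <= c) -> supported_in (spectral_measure A) c.
Proof.
move=> Ac; rewrite /supported_in spectral_measureE big1 ?mule0// => i _.
by rewrite diracE memNset//=; apply; rewrite in_itv/= -ler_norml.
Qed.

Lemma spectral_measure_moments n (A : 'M[C]_n) : (0 < n)%N -> A \is hermsymmx ->
  has_moments (spectral_measure A) (trace_moment A).
Proof.
move=> n0 hA; pose c := \sum_(i < n) `|(eigenvalues A)`_i|.
apply: (@has_moments_ge0 _ _ c); first exact: spectral_measure_setT.
  apply: spectral_measure_supported => i.
  by rewrite /c (bigD1 i)//= lerDl sumr_ge0.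
move=> p p0.
have mp : measurable_fun setT (fun x => (p.[x])%:E).
  by apply/measurable_EFinP; exact: measurable_horner.
have p0' (x : R) : setT x -> (0 <= (p.[x])%:E)%E by rewrite lee_fin.
rewrite ge0_integral_mscale// ge0_integral_measure_sum//.
under eq_bigr do rewrite integral_dirac// diracT mul1e.
rewrite sumEFin -EFinM; congr (_%:E).
transitivity (\sum_(j < size p) \sum_(i < n)
    n%:R^-1 * (p`_j * (eigenvalues A)`_i ^+ j)); last first.
  by apply: eq_bigr => j _; rewrite trace_momentE// mulrCA !mulr_sumr.
rewrite exchange_big /= mulr_sumr; apply: eq_bigr => i _.
by rewrite horner_coef mulr_sumr.
Qed.

End Hermitian.

(** * Convergence of polynomials through their coefficients *)

Section CoefficientConvergence.
Variable R : realType.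
Implicit Types (v : nat -> R) (n : nat).

(** Lagrange interpolation at [0, ..., n]; the values [v] are arbitrary so that they may be
    limits. *)
Definition interpolant n v : {poly R} :=
  \sum_(i < n.+1) v i *: (tnth (n.+1.-lagrange (fun i => i%:R)) i : {poly R}).

Lemma interpolantK n (p : {poly R}) : (size p <= n.+1)%N ->
  interpolant n (fun i => p.[i%:R]) = p.
Proof.
move=> sp; rewrite [RHS](lagrange_gen (ltn0Sn n) (@mulrIn R 1 (oner_neq0 R)) sp).
by apply: eq_bigr => i _; rewrite mul_polyC.
Qed.

Lemma size_interpolant n v : (size (interpolant n v) <= n.+1)%N.
Proof.
apply: (leq_trans (size_sum _ _ _)); apply/bigmax_leqP => i _.
apply: (leq_trans (size_scale_leq _ _)).
by rewrite size_lagrange_//; exact: (@mulrIn R 1 (oner_neq0 R)).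
Qed.

(** Each coefficient is a fixed linear combination of the values at the [n + 1] nodes. *)
Lemma cvg_coef n (p_ : nat -> {poly R}) v : (forall k, (size (p_ k) <= n.+1)%N) ->
  (forall i, (p_ k).[i%:R] @[k --> \oo] --> v i) ->
  forall l, (p_ k)`_l @[k --> \oo] --> (interpolant n v)`_l.
Proof.
move=> sp pv l.
have -> : (fun k => (p_ k)`_l) = fun k => \sum_(i < n.+1) (p_ k).[i%:R]
    * (tnth (n.+1.-lagrange (fun i => i%:R)) i : {poly R})`_l.
  apply/funext => k; rewrite -[in LHS](interpolantK (sp k)) coef_sum.
  by apply: eq_bigr => i _; rewrite coefZ.
rewrite coef_sum.
under [X in _ --> X]eq_bigr do rewrite coefZ.
by apply: cvg_big => [|i _]; [exact: add_continuous|apply: cvgMl; exact: pv].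
Qed.

Lemma cvg_mom_poly n (p_ : nat -> {poly R}) (p : {poly R}) (m : nat -> R) :
  (forall k, (size (p_ k) <= n.+1)%N) -> (size p <= n.+1)%N ->
  (forall l, (p_ k)`_l @[k --> \oo] --> p`_l) ->
  mom m (p_ k) @[k --> \oo] --> mom m p.
Proof.
move=> sp_ sp pc; rewrite (mom_widen _ sp).
under eq_fun do rewrite (mom_widen _ (sp_ _)).
by apply: cvg_big => [|i _]; [exact: add_continuous|apply: cvgMl; exact: pc].
Qed.

Lemma cvg_horner_poly n (p_ : nat -> {poly R}) (p : {poly R}) (t : R) :
  (forall k, (size (p_ k) <= n.+1)%N) -> (size p <= n.+1)%N ->
  (forall l, (p_ k)`_l @[k --> \oo] --> p`_l) ->
  (p_ k).[t] @[k --> \oo] --> p.[t].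
Proof.
(* Evaluation at [t] is [mom] for the moments of the Dirac mass at [t]. *)
have hE (q : {poly R}) : q.[t] = mom (fun i => t ^+ i) q by exact: horner_coef.
move=> sp_ sp pc; rewrite hE; under eq_fun do rewrite hE.
exact: cvg_mom_poly sp_ sp pc.
Qed.

Lemma horner_bounded (p : {poly R}) (K : R) :
  exists M, forall t, `|t| <= K -> `|p.[t]| <= M.
Proof.
exists (\sum_(i < size p) `|p`_i| * K ^+ i) => t tK.
rewrite horner_coef (le_trans (ler_norm_sum _ _ _))// ler_sum// => i _.
rewrite normrM normrX ler_wpM2l//; apply: lerXn2r; rewrite ?nnegrE//.
exact: le_trans tK.
Qed.

End CoefficientConvergence.

(** * Spectral measures of a pencil as a family of probabilities *)

Section SpectralFamily.
Variable R : realType.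
Local Notation C := R[i].

Lemma has_moments_ext (mu nu : {measure set R -> \bar R}) m :
  mu = nu :> (set R -> \bar R) -> has_moments nu m -> has_moments mu m.
Proof. by rewrite /has_moments /supported_in => ->. Qed.

(** [mixture_exists] asks for bundled probabilities, while [spectral_measure] is only a measure, of
    mass zero at order 0. *)
Lemma spectral_probability n (A : 'M[C]_n) : (0 < n)%N -> A \is hermsymmx ->
  exists P : probability R R, has_moments P (trace_moment A) /\
    P = spectral_measure A :> (set R -> \bar R).
Proof.
move=> n0 hA; have [P PE] := probability_of_mass1 (spectral_measure_setT A n0).
by exists P; split => //; apply: has_moments_ext PE _; exact: spectral_measure_moments.
Qed.

(* Supports are bounded locally uniformly in [t] because each squared eigenvalue is at
   most the trace of [(A + t B) ^ 2], a polynomial in [t]. *)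
Lemma pencil_family n (A B : 'M[C]_n) : (0 < n)%N ->
  A \is hermsymmx -> B \is hermsymmx ->
  exists phi : R -> probability R R,
    (forall K : R, exists c : R, forall t, `|t| <= K -> supported_in (phi t) c) /\
    (forall t j, \int[phi t]_x (x ^+ j)%:E = ((pencil_moment A B j).[t])%:E)%E.
Proof.
move=> n0 hA hB.
have hAB (t : R) : A + t%:C *: B \is hermsymmx by exact: hermsymmx_pencil.
have /choice[phi phiP] := fun t => spectral_probability n0 (hAB t).
exists phi; split => [K|t j]; last first.
  by rewrite horner_pencil_moment; have [[_ _ ->]] := phiP t.
have [M pM] := horner_bounded (pencil_moment A B 2) K.
(* From [l ^ 2 <= n M] follows [|l| <= n M + 1], as a real number is at most its square plus one. *)
exists (n%:R * M + 1) => t tK.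
have [_ phiE] := phiP t.
rewrite /supported_in [LHS](congr1 (fun P : set R -> \bar R => P _) phiE).
apply: spectral_measure_supported => i; set l := _`_i.
have l2 : l ^+ 2 <= n%:R * M.
  have := pM _ tK; rewrite horner_pencil_moment trace_momentE// => H.
  have {}H := le_trans (ler_norm _) H.
  rewrite ler_pdivrMl ?ltr0n// in H; apply: le_trans H.
  rewrite (bigD1 i)//= lerDl sumr_ge0// => k _; exact: sqr_ge0.
rewrite -real_normK ?num_real// in l2.
have := normr_ge0 l; nra.
Qed.

End SpectralFamily.

Section Supports.
Variable R : realType.

Lemma bounded_supported_in (I : Type) (D : set I) (phi : I -> probability R R) :
  bounded_set (\bigcup_(i in D) msupport (phi i)) ->
  exists C, forall i, D i -> supported_in (phi i) C.
Proof.
(* [bounded_set] provides every bound strictly above [M], hence the shift by one. *)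
move=> [M [_ bM]]; exists (M + 1) => i Di; apply: msupport_supported_in => x ix.
by rewrite /= in_itv/= -ler_norml; apply: (bM (M + 1)); [lra|exists i].
Qed.

End Supports.

(** * Almost sure convergence and identification of the limits *)

Theorem theorem1 (R : realType) (d : measure_display) (T : measurableType d)
    (P : probability T R)
    (A B W : forall n : nat, T -> 'M[R[i]]_n)
    (hA : forall n, hermitian_random_matrix (A n))
    (hB : forall n, hermitian_random_matrix (B n))
    (hW : forall n, hermitian_random_matrix (W n))
    (mu_omega : probability R R)
    (mu_omega_supp : compact (msupport mu_omega))
    (mu_omega_cvg : {ae P, forall w,
       moments_cvg (fun n => spectral_measure (W n w)) mu_omega})
    (psi : R -> probability R R)
    (psi_cvg : forall t : R, {ae P, forall w,
       moments_cvg (fun n => spectral_measure (A n w + t%:C *: B n w)) (psi t)})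
    (psi_supp : forall K : set R, compact K ->
       bounded_set (\bigcup_(t in K) msupport (psi t))) :
  exists nu : probability R R,
    (forall U : set R, measurable U ->
       measurable_fun [set: R] (fun t => psi t U) /\
       nu U = (\int[mu_omega]_t psi t U)%E) /\
    {ae P, forall w,
      (exists nu1 : nat -> probability R R,
        (forall n, (0 < n)%N ->
          weak_cvg (fun k => spectral_measure (kron_model (A n w) (B n w) (W k w)))
                   (nu1 n)) /\
        weak_cvg (fun n => nu1 n) nu) /\
      (exists nu2 : nat -> probability R R,
        (forall k, (0 < k)%N ->
          weak_cvg (fun n => spectral_measure (kron_model (A n w) (B n w) (W k w)))
                   (nu2 k)) /\
        weak_cvg (fun k => nu2 k) nu)}.
Proof.
have psi_bnd (K : R) : exists C : R, forall t, `|t| <= K -> supported_in (psi t) C.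
  have [C psiC] := bounded_supported_in (psi_supp _ (@segment_compact R (- K) K)).
  by exists C => t tK; apply: psiC; rewrite /= in_itv/= -ler_norml.
pose mpsi t j := fine (\int[psi t]_x (x ^+ j)%:E)%E.
have hpsi t : has_moments (psi t) (mpsi t).
  have [C psiC] := psi_bnd `|t|.
  exact: has_moments_exists (probability_setT (psi t)) (psiC t (lexx _)).
have [momega homega] : exists m, has_moments mu_omega m.
  (* The single measure [mu_omega] is treated as a family indexed by [unit]. *)
  have [C muC] : exists C, forall i, [set: unit] i -> supported_in mu_omega C.
    apply: (@bounded_supported_in R unit setT (fun=> mu_omega)).
    apply: compact_bounded; rewrite (_ : \bigcup_(_ in _) _ = msupport mu_omega)//.
    by apply/seteqP; split => [x [_ _]//|x mx]; exists tt.
  by eexists; exact: has_moments_exists (probability_setT mu_omega) (muC tt I).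
pose c n w := pencil_moment (A n w) (B n w).
(* The candidate limit of [c n w j], built from the [j]-th moments of [psi t] at [t = 0, ..., j]. *)
pose M j := interpolant j (fun i => mpsi i%:R j).
have sizec n w j : (size (c n w j) <= j.+1)%N by exact: size_poly.
have sizeM j : (size (M j) <= j.+1)%N by exact: size_interpolant.
have hAB n w (t : R) : A n w + t%:C *: B n w \is hermsymmx.
  by apply: hermsymmx_pencil; [exact: (hA n).1|exact: (hB n).1].
have cvg_c t w : moments_cvg (fun n => spectral_measure (A n w + t%:C *: B n w)) (psi t) ->
    forall j, (c n w j).[t] @[n --> \oo] --> mpsi t j.
  move=> cvgt j; under eq_fun do rewrite horner_pencil_moment.
  apply: (moments_cvg_real _ (hpsi t) cvgt (m_ := fun n => _)).
  near=> n; apply: spectral_measure_moments; last exact: hAB.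
  by near: n; exact: nbhs_infty_gt.
have ae_nat : {ae P, forall w, forall i : nat,
    moments_cvg (fun n => spectral_measure (A n w + i%:R%:C *: B n w)) (psi i%:R)}.
  by apply: ae_foralln => i; exact: psi_cvg.
have cvg_cM w : (forall i : nat,
    moments_cvg (fun n => spectral_measure (A n w + i%:R%:C *: B n w)) (psi i%:R)) ->
    forall j l, (c n w j)`_l @[n --> \oo] --> (M j)`_l.
  by move=> cvgi j; apply: cvg_coef => // i; exact: cvg_c.
(* A deterministic identity obtained from one outcome: the event for the given [t] and that for all
   naturals have probability one, hence share some [w]. There [(c n w j).[t]] tends to both
   sides. *)
have psiM t j : (\int[psi t]_x (x ^+ j)%:E)%E = ((M j).[t])%:E.
  have PP : ProperFilter (almost_everywhere P).
    apply: ae_properfilter_algebraOfSetsType.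
    by rewrite [X in (_ < X)%E](probability_setT P) lte01.
  have [w [/cvg_cM cvgM /cvg_c cvgt]] := filter_ex (filterI ae_nat (psi_cvg t)).
  have [_ _ ->] := hpsi t; congr (_%:E).
  have cM := @cvg_horner_poly R j (fun n => c n w j) (M j) t
    (fun n => sizec n w j) (sizeM j) (cvgM j).
  exact: (cvg_unique _ (cvgt j) cM).
have [nu [nuE hnu]] := mixture_exists psi_bnd psiM homega.
exists nu; split.
  by move=> U mU; split; [exact: (measurable_family psi_bnd psiM)|exact: nuE].
apply: filterS2 mu_omega_cvg ae_nat => w cvgW /cvg_cM cvgM.
have hWw k := (hW k).1 w.
have cvg_mW j : trace_moment (W k w) j @[k --> \oo] --> momega j.
  apply: (moments_cvg_real _ homega cvgW (m_ := fun k => _)).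
  near=> k; apply: spectral_measure_moments; last exact: hWw.
  by near: k; exact: nbhs_infty_gt.
have hkron n k : (0 < n)%N -> (0 < k)%N ->
    has_moments (spectral_measure (kron_model (A n w) (B n w) (W k w)))
      (fun j => mom (trace_moment (W k w)) (c n w j)).
  move=> n0 k0.
  have -> : (fun j => mom (trace_moment (W k w)) (c n w j)) =
      trace_moment (kron_model (A n w) (B n w) (W k w)).
    by apply/funext => j; rewrite trace_moment_kron.
  apply: spectral_measure_moments; first by rewrite muln_gt0 k0.
  by apply: hermsymmx_kron; [exact: (hA n).1|exact: (hB n).1|].
split.
(* [nu1 n] mixes the spectral measures of [A n w + t B n w] over [mu_omega]; [nu] is a filler at
   index 0. *)
- have /choice[nu1 nu1P] n : exists q : probability R R, (0 < n)%N ->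
      has_moments q (fun j => mom momega (c n w j)).
    have [->|n0] := posnP n; first by exists nu.
    have [phi [phi_bnd phi_mom]] := pencil_family n0 ((hA n).1 w) ((hB n).1 w).
    by have [q [_ hq]] := mixture_exists phi_bnd phi_mom homega; exists q.
  exists nu1; split => [n n0|].
  + apply: (weak_cvg_of_moments _ (nu1P n n0)
        (m_ := fun k j => mom (trace_moment (W k w)) (c n w j))).
      by near=> k; apply: hkron => //; near: k; exact: nbhs_infty_gt.
    by move=> j; apply: (@cvg_mom R (fun k => trace_moment (W k w))); exact: cvg_mW.
  (* Here [momega] is fixed and the coefficients of [c n w j] converge to those of [M j]. *)
  + apply: (weak_cvg_of_moments _ hnu (m_ := fun n j => mom momega (c n w j))).
      by near=> n; apply: nu1P; near: n; exact: nbhs_infty_gt.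
    by move=> j; exact: cvg_mom_poly (fun n => sizec n w j) (sizeM j) (cvgM j).
(* [nu2 k] mixes the [psi t] over the spectral measure of [W k w], with the same filler. *)
- have /choice[nu2 nu2P] k : exists q : probability R R, (0 < k)%N ->
      has_moments q (fun j => mom (trace_moment (W k w)) (M j)).
    have [->|k0] := posnP k; first by exists nu.
    have [Q [hQ _]] := spectral_probability k0 (hWw k).
    by have [q [_ hq]] := mixture_exists psi_bnd psiM hQ; exists q.
  exists nu2; split => [k k0|].
  + apply: (weak_cvg_of_moments _ (nu2P k k0)
        (m_ := fun n j => mom (trace_moment (W k w)) (c n w j))).
      by near=> n; apply: hkron => //; near: n; exact: nbhs_infty_gt.
    by move=> j; exact: cvg_mom_poly (fun n => sizec n w j) (sizeM j) (cvgM j).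
  (* Here [M j] is fixed and the moments of [W k w] converge. *)
  + apply: (weak_cvg_of_moments _ hnu
        (m_ := fun k j => mom (trace_moment (W k w)) (M j))).
      by near=> k; apply: nu2P; near: k; exact: nbhs_infty_gt.
    by move=> j; apply: (@cvg_mom R (fun k => trace_moment (W k w))); exact: cvg_mW.
Unshelve. all: by end_near.
Qed.
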